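(* Every directed graph $D$ on $n$ vertices has at most $\mathcal{O}^*(1.4549^n)$ inclusion-wise minimal knot-free vertex deletion sets. Moreover, there is an infinite family of directed graphs such that each member on $n$ vertices has $\Omega(1.4422^n)$ inclusion-wise minimal knot-free vertex deletion sets.
   Context: All digraphs are finite, without loops or parallel arcs. A knot in a digraph $D$ is a strongly connected component $K$ with $|V(K)|\ge 2$ such that there is no arc $(u,v)$ with $u\in V(K)$ and $v\notin V(K)$. $D$ is knot-free if it contains no knot. A knot-free vertex deletion set of $D$ is a set $S\subseteq V(D)$ such that the subgraph $D-S$ induced on $V(D)\setminus S$ is knot-free; it is inclusion-wise minimal if no proper subset of it is a knot-free vertex deletion set. $\mathcal{O}^*(\cdot)$ suppresses factors polynomial in $n$. *)

(* Defs.v *)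
From mathcomp Require Import all_boot all_order all_algebra.

Set Implicit Arguments.
Unset Strict Implicit.
Unset Printing Implicit Defensive.

(* Arcs form a relation, so there are no parallel arcs; opposite arcs (u, v)
   and (v, u) are allowed. *)
Record digraph := Digraph {
  vertex :> finType;
  arc : rel vertex;
  arc_irrefl : irreflexive arc }.

Lemma induced_irrefl (D : digraph) (A : {set D}) :
  irreflexive [rel u v : {x : D | x \in A} | arc (val u) (val v)].
Proof. by move=> u; apply: arc_irrefl. Qed.

Definition induced (D : digraph) (A : {set D}) : digraph :=
  Digraph (@induced_irrefl D A).

Definition strongly_connected (D : digraph) : bool :=
  [forall x : D, forall y : D, connect (@arc D) x y].

(* [set0] is a strongly connected component only when [D] has no vertex. *)
Definition scc (D : digraph) (K : {set D}) : bool :=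
  maxset [pred A : {set D} | strongly_connected (induced A)] K.

Definition knot (D : digraph) (K : {set D}) : bool :=
  [&& scc K, 2 <= #|K|
    & ~~ [exists u : D, exists v : D, [&& u \in K, v \notin K & arc u v]]].

Definition knot_free (D : digraph) : bool := ~~ [exists K : {set D}, knot K].

Definition kfvd_set (D : digraph) (S : {set D}) : bool :=
  knot_free (induced (~: S)).

Definition minimal_kfvd_sets (D : digraph) : {set {set D}} :=
  [set S : {set D} | minset (@kfvd_set D) S].

(* Main.v *)
(* A digraph is knot-free iff each of its vertices reaches a sink, so minimal
   knot-free deletion sets are the complements of the maximal vertex sets [A]
   inside which every vertex reaches a sink.  Let [z] be a sink of such an [A]
   in an ambient vertex set [W], and let [T z] ([zone W z]) be [z], its out-neighbours
   in [W], and the vertices which reach [z] in [W] avoiding these out-neighbours.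
   Maximality forces [A] to contain all vertices of the last kind, so [A] is
   determined by its trace on [W - T z], which is again maximal there.
   Conversely every vertex of [W] lies in [T z] for some sink [z] of [A].  Hence,
   writing [f W] for the number of maximal sets,
     f W <= \sum_(z | v \in T z) f (W - T z)  for every v in W.
   Summing x ^- #|T z| over all pairs v \in T z gives
   \sum_z #|T z| x ^- #|T z| <= #|W| as soon as t <= x ^ t for every natural t;
   so some v satisfies \sum_(z | v \in T z) x ^- #|T z| <= 1, and f W <= x ^ #|W|
   by induction.  This allows x down to the cube root of 3, which disjoint unions
   of bidirected triangles show to be optimal. *)
Require Import Defs.
From mathcomp Require Import all_boot all_order all_algebra.
From mathcomp Require Import lra.

Set Implicit Arguments.
Unset Strict Implicit.
Unset Printing Implicit Defensive.

Import Order.TTheory GRing.Theory Num.Theory.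
Local Open Scope ring_scope.

(* [path.arc] would otherwise shadow the arc relation of a digraph. *)
Local Notation arc := Defs.arc.

(** * Knot-freeness as reachability of sinks *)

(** A relation on all of [D] rather than on the subtype of [induced A], so that reachability inside
    different vertex sets can be compared. *)
Definition arc_in (D : digraph) (A : {set D}) : rel D :=
  fun x y => [&& x \in A, y \in A & arc x y].
Arguments arc_in D A x y /.

Definition sinks (D : digraph) (A : {set D}) : {set D} :=
  [set s in A | [forall w in A, ~~ arc s w]].

Definition reaches_sinks (D : digraph) (A : {set D}) : bool :=
  [forall v in A, exists s in sinks A, connect (arc_in A) v s].

Lemma sinksP {D : digraph} {A : {set D}} {s : D} :
  reflect (s \in A /\ forall w, w \in A -> ~~ arc s w) (s \in sinks A).
Proof. by rewrite inE; apply: (iffP andP) => -[sA /forall_inP]. Qed.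

Lemma reaches_sinksP {D : digraph} {A : {set D}} :
  reflect (forall v, v \in A -> exists2 s, s \in sinks A & connect (arc_in A) v s)
          (reaches_sinks A).
Proof.
by apply: (iffP forall_inP) => h v /h => [/exists_inP|?]; last exact/exists_inP.
Qed.

Lemma sub_arc_in (D : digraph) (A B : {set D}) (u v : D) :
  A \subset B -> connect (arc_in A) u v -> connect (arc_in B) u v.
Proof.
move=> /subsetP AB; move: u v; apply: connect_sub => x y /and3P[xA yA xy].
by apply: connect1; rewrite /= !AB.
Qed.

Lemma connect_induced (D : digraph) (A : {set D}) (x y : induced A) :
  connect (@arc (induced A)) x y = connect (arc_in A) (val x) (val y).
Proof.
apply/idP/idP => [/connectP[p] | /connectP[p]].
- elim: p x => [|z p IH] x /= => [_ -> //|/andP[xz zp] yE].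
  apply: connect_trans (IH _ zp yE).
  by apply: connect1; rewrite /= (valP x) (valP z).
- elim: p x => [|z p IH] x /= => [_ /val_inj -> //|/andP[/and3P[_ zA xz] zp] yE].
  have := IH (exist _ z zA) zp yE; apply: connect_trans.
  exact: connect1.
Qed.

Lemma arc_inT (D : digraph) : connect (arc_in [set: D]) =2 connect (@arc D).
Proof. by apply: eq_connect => x y; rewrite /= !in_setT. Qed.

Lemma strongly_connected_induced (D : digraph) (A : {set D}) :
  strongly_connected (induced A) =
    [forall x in A, forall y in A, connect (arc_in A) x y].
Proof.
apply/forallP/forall_inP => [h x xA|h x].
- apply/forall_inP => y yA.
  by have := forallP (h (exist _ x xA)) (exist _ y yA); rewrite connect_induced.
- apply/forallP => y; rewrite connect_induced.
  exact: (forall_inP (h _ (valP x))) (valP y).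
Qed.

Lemma connect_closed (D : digraph) (A : {set D}) :
  (forall x y, x \in A -> arc x y -> y \in A) ->
  forall x y, x \in A -> connect (@arc D) x y ->
    (y \in A) && connect (arc_in A) x y.
Proof.
move=> clA x y xA /connectP[p]; elim: p x xA => [|z p IH] x xA /=.
  by move=> _ ->; rewrite xA connect0.
case/andP=> xz zp yE; have zA := clA x z xA xz.
have /andP[-> zy] := IH z zA zp yE.
by apply: connect_trans zy; apply: connect1; rewrite /= xA zA.
Qed.

(* A vertex whose set of descendants is smallest among those reachable from [v]
   is either a sink or generates a knot. *)
Lemma knot_freeE (D : digraph) : knot_free D = reaches_sinks [set: D].
Proof.
apply/idP/reaches_sinksP => [kfD v _ | h].
- pose reach (s : D) := [set t | connect (@arc D) s t].
  case: (arg_minnP (fun s => #|reach s|) (connect0 (@arc D) v)) => s vs mins.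
  (* By minimality, moving on from [s] loses no descendant, so [reach s] is strongly connected. *)
  have reach_s t : connect (@arc D) s t -> reach t = reach s.
    move=> st; apply/eqP; rewrite eqEcard mins ?(connect_trans vs) // andbT.
    by apply/subsetP => w; rewrite !inE; apply: connect_trans.
  have clos x y : x \in reach s -> arc x y -> y \in reach s.
    by rewrite !inE => sx xy; apply: connect_trans sx (connect1 xy).
  exists s; last by rewrite arc_inT.
  apply/sinksP; split=> [|w _]; first by rewrite in_setT.
  apply: contra kfD => sw; apply/existsP; exists (reach s); apply/and3P; split.
  + apply/maxsetP; split=> [|B /= + sB].
      rewrite /= strongly_connected_induced; apply/forall_inP => x sx.
      apply/forall_inP => y; rewrite -{1}(reach_s x); last by move: sx; rewrite inE.
      by rewrite inE => /(connect_closed clos sx)/andP[].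
    rewrite strongly_connected_induced => /forall_inP scB.
    apply/eqP; rewrite eqEsubset sB andbT; apply/subsetP => y yB.
    have ssB : s \in B by apply: (subsetP sB); rewrite inE connect0.
    have := forall_inP (scB _ ssB) _ yB.
    by rewrite inE -arc_inT; apply/sub_arc_in/subsetT.
  + rewrite (cardD1 s) (cardD1 w) !inE connect0 (connect1 sw).
    by case: eqP sw => // ->; rewrite arc_irrefl.
  + apply/negP => /existsP[x /existsP[y /and3P[xs /negP yNs xy]]].
    exact/yNs/(clos x).
(* A sink reached from a knot [K] lies in [K], but a path to a second vertex of [K] gives it an
   out-arc. *)
- apply/negP => /existsP[K /and3P[/maxsetP[/= + _] K2 /negP clK]].
  rewrite strongly_connected_induced => /forall_inP scK.
  have {}clK x y : x \in K -> arc x y -> y \in K.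
    move=> xK xy; apply: contra_notT clK => yK.
    by apply/existsP; exists x; apply/existsP; exists y; rewrite xK yK.
  have [v vK] : exists v, v \in K by apply/card_gt0P/(leq_trans _ K2).
  have [s /sinksP[_ ss]] := h v (in_setT v).
  rewrite arc_inT => /(connect_closed clK vK)/andP[sK _].
  have [t tK ts] : exists2 t, t \in K & t != s.
    have : (0 < #|K :\ s|)%N by move: K2; rewrite (cardsD1 s) sK.
    by case/card_gt0P=> t; rewrite !inE => /andP[]; exists t.
  have /connectP[[|w p] /=] := forall_inP (scK _ sK) _ tK.
    by move=> _ tE; rewrite tE eqxx in ts.
  by case/andP=> /and3P[_ _ sw]; rewrite (negPf (ss w (in_setT w))) in sw.
Qed.

Lemma kfvd_setE (D : digraph) (S : {set D}) :
  kfvd_set S = reaches_sinks (~: S).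
Proof.
rewrite /kfvd_set knot_freeE; apply/reaches_sinksP/reaches_sinksP => h v vS.
- have [s /sinksP[_ ss]] := h (exist _ v vS) (in_setT _).
  rewrite arc_inT connect_induced => vs; exists (val s) => //.
  apply/sinksP; split=> [|w wS]; first exact: valP.
  exact: (ss (exist _ w wS) (in_setT _)).
- have [s /sinksP[sS ss]] := h _ (valP v).
  exists (exist _ s sS); last by rewrite arc_inT connect_induced.
  apply/sinksP; split=> [|w _]; first exact: in_setT.
  exact: ss (valP w).
Qed.

(** * Zones of sinks and maximal sets *)

Definition outs (D : digraph) (z : D) : {set D} := [set y | arc z y].

Definition basin (D : digraph) (W : {set D}) (z : D) : {set D} :=
  [set v in W :\: outs z | connect (arc_in (W :\: outs z)) v z].

Definition zone (D : digraph) (W : {set D}) (z : D) : {set D} :=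
  (W :&: outs z) :|: basin W z.

Definition maximal_in (D : digraph) (W : {set D}) : {set {set D}} :=
  [set A | maxset [pred B : {set D} | (B \subset W) && reaches_sinks B] A].

Lemma maximal_inP {D : digraph} {W A : {set D}} :
  reflect [/\ A \subset W, reaches_sinks A
            & forall B : {set D}, B \subset W -> reaches_sinks B -> A \subset B -> B = A]
          (A \in maximal_in W).
Proof.
rewrite inE; apply: (iffP maxsetP) => [[/= /andP[AW kA] mA]|[AW kA mA]].
  by split=> // B BW kB; apply: mA; rewrite /= BW.
by split=> [|B /= /andP[]]; [rewrite /= AW | apply: mA].
Qed.

Lemma maximal_in_mem (D : digraph) (W A : {set D}) (u : D) :
  A \in maximal_in W -> u \in W -> reaches_sinks (u |: A) -> u \in A.
Proof.
case/maximal_inP=> AW _ mA uW ku; rewrite -(mA _ _ ku (subsetUr _ _)) ?setU11 //.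
by rewrite subUset sub1set uW.
Qed.

(** Only sinks of [A] with an arc to [u] cease to be sinks, and these now reach [z] through [u] and
    [w]. *)
Lemma reaches_sinksU1 (D : digraph) (A : {set D}) (u w z : D) :
  reaches_sinks A -> z \in sinks A -> ~~ arc z u ->
  w \in A -> arc u w -> connect (arc_in A) w z -> reaches_sinks (u |: A).
Proof.
move=> /reaches_sinksP kA /sinksP[zA zs] zu wA uw wz.
have AuA : A \subset u |: A := subsetUr _ _.
have zsu : z \in sinks (u |: A).
  apply/sinksP; split=> [|y]; first by rewrite !inE zA orbT.
  by rewrite !inE => /predU1P[->|/zs].
have uz : connect (arc_in (u |: A)) u z.
  apply: connect_trans (sub_arc_in AuA wz).
  by apply: connect1; rewrite /= setU11 (subsetP AuA) // uw.
apply/reaches_sinksP => v /setU1P[->|vA]; first by exists z.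
have [s /sinksP[sA ss] vs] := kA v vA.
have {}vs := sub_arc_in AuA vs.
have [su|nsu] := boolP (arc s u).
  exists z => //; apply: connect_trans vs (connect_trans _ uz).
  by apply: connect1; rewrite /= setU11 (subsetP AuA) ?su.
exists s => //; apply/sinksP; split=> [|y]; first by rewrite !inE sA orbT.
by rewrite !inE => /predU1P[->|/ss].
Qed.

(** Going back from [z] along a path, each predecessor has an arc into [A] and none from [z], so
    maximality puts it in [A]. *)
Lemma basin_sub (D : digraph) (W A : {set D}) (z : D) :
  A \in maximal_in W -> z \in sinks A -> basin W z \subset A.
Proof.
move=> mA zs; have [zA zsink] := sinksP zs.
have [_ kA _] := maximal_inP mA.
apply/subsetP => v; rewrite inE => /andP[_ /connectP[p]].
suff : path (arc_in (W :\: outs z)) v p -> z = last v p ->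
         (v \in A) && connect (arc_in A) v z by move=> h h1 h2; case/andP: (h h1 h2).
elim: p v => [|w p IH] v /=; first by move=> _ <-; rewrite zA connect0.
case/andP=> /and3P[vW _ vw] wp zE; have /andP[wA wz] := IH w wp zE.
move: vW; rewrite !inE => /andP[zv vW].
have vA : v \in A by apply: maximal_in_mem mA vW (reaches_sinksU1 kA zs zv wA vw wz).
by rewrite vA; apply: connect_trans wz; apply: connect1; rewrite /= vA wA.
Qed.

Lemma zone_cover (D : digraph) (W A : {set D}) (v : D) :
  A \in maximal_in W -> v \in W -> exists2 z, z \in sinks A & v \in zone W z.
Proof.
move=> mA vW; have [AW /[dup] kA /reaches_sinksP rA _] := maximal_inP mA.
have [vA|vNA] := boolP (v \in A).
  (* As [z] is a sink of [A], the path to it inside [A] avoids the out-neighbours of [z]. *)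
  have [z /[dup] zs /sinksP[zA zsink] vz] := rA v vA.
  have AWz : A \subset W :\: outs z.
    by apply/subsetP => y yA; rewrite !inE zsink // (subsetP AW).
  exists z => //; rewrite !inE zsink // vW /=.
  by apply/orP; right; exact: sub_arc_in AWz vz.
(* If no sink of [A] points to [v], then [v] can be added: it has an arc into [A] or becomes a new
   sink. *)
apply/exists_inP; apply: contraNT vNA => /exists_inPn noz.
have nov z : z \in sinks A -> ~~ arc z v.
  by move=> /noz; rewrite !inE vW negb_or => /andP[].
apply: maximal_in_mem mA vW _.
have [/exists_inP[w wA vw]|/exists_inPn vsink] := boolP [exists w in A, arc v w].
  have [z zs wz] := rA w wA.
  exact: reaches_sinksU1 kA zs (nov z zs) wA vw wz.
apply/reaches_sinksP => x /setU1P[->|xA].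
  exists v => //; apply/sinksP; split=> [|y]; first exact: setU11.
  by move=> /setU1P[->|/vsink//]; rewrite arc_irrefl.
have [s /[dup] /nov sv /sinksP[sA ss] xs] := rA x xA; exists s; last first.
  exact: sub_arc_in (subsetUr _ _) xs.
apply/sinksP; split=> [|y]; first by rewrite !inE sA orbT.
by move=> /setU1P[->|/ss].
Qed.

Lemma mem_zone (D : digraph) (W : {set D}) (z : D) : z \in W -> z \in zone W z.
Proof. by move=> zW; rewrite !inE zW arc_irrefl connect0. Qed.

Lemma zone_sub (D : digraph) (W : {set D}) (z : D) : zone W z \subset W.
Proof. by apply/subsetP => v; rewrite !inE => /orP[]/andP[] // /andP[]. Qed.

(** Unless [x] is an out-neighbour of [z], it extends a path from [y] to [z]. Thus no arc enters the
    basin from [W] minus the zone. *)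
Lemma arc_basin (D : digraph) (W : {set D}) (x y z : D) :
  x \in W -> arc x y -> y \in basin W z -> x \in zone W z.
Proof.
move=> xW xy; rewrite in_setU !in_setI xW inE => /andP[yW yz].
have [//|xz] := boolP (x \in outs z); rewrite /= inE in_setD xz xW /=.
by apply: connect_trans yz; apply: connect1; rewrite /= in_setD xz xW yW.
Qed.

Lemma maximal_in_zone (D : digraph) (W A : {set D}) (z : D) :
  A \in maximal_in W -> z \in sinks A ->
  A :&: zone W z = basin W z.
Proof.
move=> mA zs; have [zA zsink] := sinksP zs.
rewrite setIUr (setIidPr (basin_sub mA zs)).
apply/setUidPr/subsetP => y; rewrite in_setI => /andP[/zsink] + /setIP[_].
by rewrite inE => /negPf->.
Qed.

(** Paths of [A] starting outside the zone stay outside. Maximality is inherited because a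
    competitor [B] together with the basin competes with [A]. *)
Lemma maximal_in_zoneD (D : digraph) (W A : {set D}) (z : D) :
  A \in maximal_in W -> z \in sinks A ->
  A :\: zone W z \in maximal_in (W :\: zone W z).
Proof.
move=> mA zs; have [zA zsink] := sinksP zs.
have AzE := maximal_in_zone mA zs.
have [AW /reaches_sinksP rA maxA] := maximal_inP mA.
have zW := subsetP AW z zA.
apply/maximal_inP; split=> [||B BW /reaches_sinksP rB AB]; first exact: setSD.
- apply/reaches_sinksP => v /setDP[vA vz].
  have [s /sinksP[sA ss] /connectP[p vp sE]] := rA v vA.
  suff: (s \notin zone W z) && connect (arc_in (A :\: zone W z)) v s.
    case/andP=> sz vs; exists s => //; apply/sinksP.
    by split=> [|y /setDP[/ss]] //; rewrite in_setD sz.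
  elim: p v vA vz vp sE => [|w p IH] v vA vz /=; first by move=> _ ->; rewrite vz connect0.
  case/andP=> /and3P[_ wA vw] wp sE.
  (* [A] meets the zone only in the basin, which arcs from outside the zone cannot enter. *)
  have wz : w \notin zone W z.
    apply: contra vz => wz; apply: arc_basin vw _; first exact: (subsetP AW).
    by rewrite -AzE inE wA.
  have /andP[-> ws] := IH w wA wz wp sE.
  by apply: connect_trans ws; apply: connect1; rewrite /= !in_setD vA vz wA wz.
- have BWz y : y \in B -> (y \in W) && (y \notin zone W z).
    by move=> /(subsetP BW); rewrite in_setD andbC.
  have Rz y : y \in basin W z -> y \in zone W z by rewrite /zone in_setU => ->; rewrite orbT.
  have zBR : z \in sinks (B :|: basin W z).
    apply/sinksP; split=> [|y].
      by rewrite in_setU -AzE in_setI zA mem_zone ?orbT.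
    case/setUP=> [/BWz/andP[yW]|]; first by rewrite !inE yW negb_or => /andP[].
    by rewrite !inE => /andP[/andP[]].
  suff BRA : B :|: basin W z = A.
    rewrite -BRA setDUl (_ : basin W z :\: _ = set0) ?setU0.
      apply/esym/setDidPl; rewrite disjoint_subset; apply/subsetP => y.
      by rewrite inE => /BWz/andP[].
    by apply/eqP; rewrite setD_eq0; apply/subsetP.
  apply: maxA.
  + rewrite subUset (subset_trans BW (subsetDl _ _)) /=.
    by apply: subset_trans (zone_sub W z); apply/subsetP.
  + apply/reaches_sinksP => v /setUP[vB|].
      (* An arc from a sink of [B] into the basin would put that sink in the zone. *)
      have [s /sinksP[sB ss] vs] := rB v vB; exists s; last first.
        exact: sub_arc_in (subsetUl _ _) vs.
      apply/sinksP; split=> [|y]; first by rewrite in_setU sB.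
      case/setUP=> [/ss//|yR]; have /andP[sW] := BWz s sB.
      by apply: contra => sy; apply: arc_basin sy yR.
    rewrite inE => /andP[vW /connectP[p vp zE]]; exists z => //.
    (* Every vertex of this path lies in the basin again. *)
    elim: p v vW vp zE => [|w p IH] v vW /=; first by move=> _ ->.
    case/andP=> /[dup] vwW /and3P[_ wW vw] wp zE.
    have wz : connect (arc_in (W :\: outs z)) w z by apply/connectP; exists p.
    have vz : connect (arc_in (W :\: outs z)) v z by apply: connect_trans wz; apply: connect1.
    apply: connect_trans (IH w wW wp zE); apply: connect1.
    rewrite /= !in_setU vw andbT /basin [v \in finset _]inE [w \in finset _]inE.
    by rewrite vW wW wz vz !orbT.
  + apply/subsetP => y yA; rewrite in_setU -AzE in_setI yA /=.
    by case: (boolP (y \in zone W z)) => yz; rewrite ?orbT // (subsetP AB) // in_setD yz.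
Qed.

(** * Counting maximal sets *)

(** Inside the zone such a set equals [basin W z], so its trace outside determines it. *)
Lemma card_maximal_in_sink (D : digraph) (W : {set D}) (z : D) :
  (#|[set A in maximal_in W | z \in sinks A]|
     <= #|maximal_in (W :\: zone W z)|)%N.
Proof.
rewrite -(card_in_imset (f := fun A => A :\: zone W z)) => [|A B].
  apply/subset_leq_card/subsetP => _ /imsetP[A + ->].
  by rewrite inE => /andP[mA zA]; apply: maximal_in_zoneD.
rewrite !inE => /andP[mA zA] /andP[mB zB] AB.
rewrite -(setID A (zone W z)) -(setID B (zone W z)) AB.
by congr (_ :|: _); rewrite !maximal_in_zone ?inE.
Qed.

Lemma card_maximal_in (R : realFieldType) (x : R) (D : digraph) (W : {set D}) :
  0 < x -> (forall t : nat, t%:R <= x ^+ t) ->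
  #|maximal_in W|%:R <= x ^+ #|W|.
Proof.
move=> x0 xt; have [n] := ubnP #|W|; elim: n W => // n IH W /ltnSE leWn.
have [->|/set0Pn[w wW]] := eqVneq W set0.
  rewrite cards0 expr0 -[1]/(1%:R) ler_nat -(cards1 (@set0 D)).
  apply/subset_leq_card/subsetP => A /maximal_inP[+ _ _].
  by rewrite subset0 inE.
pose c z := x ^- #|zone W z|.
have [v vW cv] : exists2 v, v \in W & \sum_(z in W | v \in zone W z) c z <= 1.
  (* Otherwise the sum over [v] exceeds [#|W|], whereas after exchanging sums each [z] contributes
     [#|zone W z| * c z <= 1]. *)
  apply/exists_inP; apply: contraT => /exists_inPn h.
  have : \sum_(v in W) 1 < \sum_(v in W) \sum_(z in W | v \in zone W z) c z.
    by apply: ltr_sum => [|v vW]; [apply/hasP; exists w; rewrite ?mem_index_enum | rewrite ltNge h].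
  rewrite (exchange_big_dep (mem W)) /= => [|i j _ /andP[]//]; rewrite ltNge => /negP[]; apply: ler_sum => z zW.
  rewrite (eq_bigl (mem (zone W z))) => [|v]; last first.
    by rewrite zW; apply: andb_idl; apply: (subsetP (zone_sub W z)).
  by rewrite sumr_const -[_ *+ _]mulr_natl ler_pdivrMr ?exprn_gt0 // mul1r.
have cover : maximal_in W \subset
    \bigcup_(z in W | v \in zone W z) [set A in maximal_in W | z \in sinks A].
  apply/subsetP => A mA; have [z zs vz] := zone_cover mA vW.
  apply/bigcupP; exists z; last by rewrite inE mA.
  have [zA _] := sinksP zs; have [AW _ _] := maximal_inP mA.
  by rewrite vz (subsetP AW).
have : #|maximal_in W|%:R <= \sum_(z in W | v \in zone W z) x ^+ #|W| * c z.
  apply: le_trans (_ : \sum_(z in W | v \in zone W z)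
                         #|maximal_in (W :\: zone W z)|%:R <= _).
    rewrite -natr_sum ler_nat; apply: leq_trans (subset_leq_card cover) _.
    elim/big_rec2: _ => [|z m B _ leB]; first by rewrite cards0.
    apply: leq_trans (leq_card_setU _ _) (leq_add _ leB).
    exact: card_maximal_in_sink.
  apply: ler_sum => z /andP[zW _].
  have zone_leW := subset_leq_card (zone_sub W z).
  have cW : #|W :\: zone W z| = (#|W| - #|zone W z|)%N.
    by rewrite cardsD (setIidPr (zone_sub W z)).
  have zone_gt0 : (0 < #|zone W z|)%N.
    by apply/card_gt0P; exists z; apply: mem_zone.
  rewrite -expfB_cond ?(gt_eqF x0) // -cW; apply: IH.
  by rewrite cW (leq_trans _ leWn) // ltn_subrL zone_gt0 (leq_trans zone_gt0).
move=> /le_trans; apply; rewrite -mulr_sumr ler_piMr // exprn_ge0 //.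
exact: ltW.
Qed.

(** Complementation is injective and reverses inclusion. *)
Lemma card_minimal_kfvd_sets (D : digraph) :
  (#|minimal_kfvd_sets D| <= #|maximal_in [set: D]|)%N.
Proof.
rewrite -(card_imset _ (@setC_inj D)); apply/subset_leq_card/subsetP.
move=> _ /imsetP[S + ->]; rewrite inE => /minsetP[kS minS].
apply/maximal_inP; split=> [||B _ kB SB]; first exact: subsetT.
  by rewrite -kfvd_setE.
by rewrite -[LHS]setCK; congr (~: _); apply: minS; rewrite ?kfvd_setE ?setCK // subCset.
Qed.

(** * Lower bound from disjoint triangles *)

Definition triangle_arc (k : nat) : rel ('I_k * 'I_3) :=
  fun u v => (u.1 == v.1) && (u.2 != v.2).
Arguments triangle_arc k u v /.

Lemma triangle_arc_irrefl (k : nat) : irreflexive (@triangle_arc k).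
Proof. by move=> u; rewrite /triangle_arc /= !eqxx. Qed.

Definition triangles (k : nat) : digraph := Digraph (@triangle_arc_irrefl k).

Lemma card_triangles (k : nat) : #|triangles k| = (3 * k)%N.
Proof. by rewrite card_prod !card_ord mulnC. Qed.

(** Each [g] selects one survivor per triangle; the survivors have no arcs among them, and deleting
    all other vertices is minimal. *)
Lemma card_minimal_triangles (k : nat) :
  (3 ^ k <= #|minimal_kfvd_sets (triangles k)|)%N.
Proof.
pose A (g : {ffun 'I_k -> 'I_3}) : {set triangles k} := [set u | u.2 == g u.1].
have injA : injective (fun g => ~: A g).
  move=> g h /setC_inj gh; apply/ffunP => i.
  have : ((i, g i) : triangles k) \in A g by rewrite inE.
  by rewrite gh inE => /eqP.
have <- : #|{ffun 'I_k -> 'I_3}| = (3 ^ k)%N by rewrite card_ffun !card_ord.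
rewrite -cardsT -(card_imset _ injA); apply/subset_leq_card/subsetP.
move=> _ /imsetP[g _ ->]; rewrite inE; apply/minsetP; split=> [|S].
  rewrite kfvd_setE setCK; apply/reaches_sinksP => v vA; exists v => //.
  apply/sinksP; split=> // w; move: vA; rewrite !inE => /eqP v2 /eqP w2.
  by rewrite /= v2 w2; case: eqP => //= ->; rewrite eqxx.
rewrite kfvd_setE => /reaches_sinksP kS SA; apply/eqP.
rewrite eqEsubset SA; apply/subsetP => u uA; rewrite -[u \in S]negbK -in_setC; apply/negP => uS.
(* The sink [s] lies in the triangle of [u]. Having no arc to [u] or to the vertex chosen by [g], it
   equals both, yet these differ. *)
have [s /sinksP[_ ss] us] := kS u uS.
have s1 : u.1 = s.1.
  case/connectP: us => p; elim: p u {uA uS} => [|w p IH] u /=; first by move=> _ ->.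
  by case/andP=> /and3P[_ _ /andP[/eqP-> _]]; apply: IH.
have gS : ((u.1, g u.1) : triangles k) \in ~: S.
  by rewrite in_setC; apply/negP => /(subsetP SA); rewrite !inE eqxx.
have := ss _ gS; rewrite /= s1 eqxx negbK => /eqP /= s2.
have := ss u uS; rewrite /= s1 eqxx /= negbK s2.
by move: uA; rewrite !inE s1 eq_sym => /negPf->.
Qed.

(* The exact threshold is the cube root of 3, forced by [t = 3]. *)
Lemma natr_le_exp (R : realFieldType) (x : R) (t : nat) :
  29 / 20 <= x -> t%:R <= x ^+ t.
Proof.
move=> x_ge; have x2 : 2 <= x ^+ 2 by rewrite expr2; nra.
have x3 : 3 <= x ^+ 3 by rewrite exprS; nra.
case: t => [|[|[|t]]]; rewrite ?expr0 ?expr1 //; try lra.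
(* From exponent 3 on, a further factor [x] raises the bound by at least [0.45 * 3 > 1]. *)
elim: t => [//|t IH]; rewrite exprS -[t.+4]addn1 natrD.
have : 3 <= t.+3%:R :> R by rewrite ler_nat.
by move: IH; set y := _ ^+ _ => IH t3; nra.
Qed.

(** 1.4422 is the cube root of 3 rounded down. *)
Lemma exp_14422_le (R : realFieldType) (k : nat) :
  (14422 / 10000) ^+ (3 * k) <= (3 ^ k)%:R :> R.
Proof.
have x3 : (14422 / 10000) ^+ 3 <= 3 :> R by rewrite !exprS expr0; lra.
have x0 : 0 <= 14422 / 10000 :> R by lra.
move: (14422 / 10000) x0 x3 => x x0 x3.
by rewrite exprM natrX lerXn2r ?nnegrE ?exprn_ge0 ?ler0n.
Qed.

Theorem theorem2 :
  (exists (p : {poly rat}) (n0 : nat),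
     forall D : digraph, (n0 <= #|D|)%N ->
       #|minimal_kfvd_sets D|%:R
         <= p.[#|D|%:R] * (14549 / 10000) ^+ #|D|)
  /\
  (exists F : digraph -> Prop,
     (forall N : nat, exists D : digraph, F D /\ (N <= #|D|)%N) /\
     exists (c : rat) (n0 : nat), 0 < c /\
       forall D : digraph, F D -> (n0 <= #|D|)%N ->
         c * (14422 / 10000) ^+ #|D| <= #|minimal_kfvd_sets D|%:R).
Proof.
split.
  (* The constant polynomial 1 suffices, since 1.4549 is at least 29/20. *)
  exists 1, 0%N => D _; rewrite hornerC mul1r -cardsT.
  apply: le_trans (_ : #|maximal_in [set: D]|%:R <= _).
    by rewrite ler_nat card_minimal_kfvd_sets.
  by apply: card_maximal_in => [|t]; [lra | apply: natr_le_exp; lra].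
exists (fun D => exists k, D = triangles k); split=> [N|].
  by exists (triangles N); split; [exists N | rewrite card_triangles leq_pmull].
exists 1, 0%N; split=> [|_ [k ->] _]; first exact: ltr01.
rewrite card_triangles mul1r; apply: le_trans (exp_14422_le rat k) _.
by rewrite ler_nat card_minimal_triangles.
Qed.
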